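(* Let $T$ be a rank-one transformation given by a cutting and stacking construction with a bounded number of cuts, i.e. $\sup_n r_n<\infty$. Then $T$ is weakly rationally ergodic (with respect to $F=I$, the level of $C_0$).
   Context: Rank-one transformation by cutting and stacking: $C_0$ is a single level $I$ of positive finite measure; column $C_n$ is cut into $r_n\ge2$ equal-width subcolumns, spacers are placed above subcolumns, and subcolumns are stacked left to right to form $C_{n+1}$; $T$ maps each level to the one above. For $F$ of positive finite measure, $u_k(F)=\mu(F\cap T^kF)/\mu(F)^2$, $a_n(F)=\sum_{k=0}^{n-1}u_k(F)$. $F$ sweeps out if $\mu(X\setminus\bigcup_{i\ge0}T^iF)=0$. $T$ is weakly rationally ergodic if there is a set $F$ of positive finite measure that sweeps out such that for all measurable $A,B\subseteq F$, $\frac{1}{a_n(F)}\sum_{k=0}^{n-1}\mu(A\cap T^kB)\to\mu(A)\mu(B)$ as $n\to\infty$. *)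

(* Defs.v *)
From HB Require Import structures.
From mathcomp Require Import all_boot all_order all_algebra.
From mathcomp Require Import all_classical all_reals all_analysis.
Set Implicit Arguments. Unset Strict Implicit. Unset Printing Implicit Defensive.
Import Order.TTheory GRing.Theory Num.Theory.
Local Open Scope classical_set_scope.
Local Open Scope ring_scope.

Section RankOne.
Variable R : realType.
(* w0 : width (= measure) of the initial level I = [0, w0[ of C_0;
   r n  : number of subcolumns C_n is cut into (r n >= 2 is a hypothesis);
   s n i: number of spacers placed above subcolumn i (i < r n) of C_n. *)
Variables (w0 : R) (r : nat -> nat) (s : nat -> nat -> nat).

Definition nspacers (n : nat) : nat := (\sum_(i < r n) s n i)%N.

Fixpoint ro_height (n : nat) : nat :=
  match n with
  | 0 => 1%N
  | n'.+1 => (r n' * ro_height n' + nspacers n')%N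
  end.

Definition ro_width (n : nat) : R := w0 / (\prod_(k < n) r k)%:R.

(* index (in C_{n+1}) of the bottom ro_level of subcolumn i of C_n *)
Definition subpos (n i : nat) : nat := (i * ro_height n + \sum_(l < i) s n l)%N.

(* left endpoint of ro_level j (0 <= j < ro_height n, counted from the bottom) of C_n.
   Levels are the intervals [L n j, L n j + ro_width n[.  The spacers added at
   stage n are laid consecutively to the right of the region
   [0, ro_height n * ro_width n[ already used by C_n. *)
Fixpoint left_end (n j : nat) : R :=
  match n with
  | 0 => 0
  | n'.+1 =>
      let i := find (fun i => (j < subpos n' i.+1)%N) (iota 0 (r n')) in
      if (j < subpos n' i + ro_height n')%N then
        (* j is in subcolumn i: the i-th slice of ro_level j - subpos of C_n' *)
        left_end n' (j - subpos n' i) + i%:R * ro_width n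
      else
        (* j is a spacer above subcolumn i *)
        (ro_height n')%:R * ro_width n'
        + ((\sum_(l < i) s n' l) + (j - subpos n' i - ro_height n'))%:R * ro_width n
  end.

Definition ro_level (n j : nat) : set R :=
  `[left_end n j, left_end n j + ro_width n[%classic.

Definition ro_space : set R :=
  \bigcup_n `[0, (ro_height n)%:R * ro_width n[%classic.

Definition I0 : set R := ro_level 0 0.

(* T maps each (non-top) ro_level of C_n to the ro_level above by translation;
   on the null set where this is undefined, T is the identity. *)
Definition rank_one_map (x : R) : R :=
  match pselect (exists nj : nat * nat,
                   (nj.2.+1 < ro_height nj.1)%N /\ ro_level nj.1 nj.2 x) with
  | left H => let nj := projT1 (cid H) in
              x + (left_end nj.1 nj.2.+1 - left_end nj.1 nj.2)
  | right _ => x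
  end.

End RankOne.

Section WRE.
Variable R : realType.
Local Notation mu := (@lebesgue_measure R).

Definition muR (A : set R) : R := fine (mu A).

Definition u_seq (T : R -> R) (F : set R) (k : nat) : R :=
  muR (F `&` (iter k T @` F)) / (muR F ^+ 2).

Definition a_seq (T : R -> R) (F : set R) (n : nat) : R :=
  \sum_(k < n) u_seq T F k.

Definition sweeps_out (X : set R) (T : R -> R) (F : set R) : Prop :=
  mu (X `\` \bigcup_i (iter i T @` F)) = 0%E.

Definition weakly_rationally_ergodic_wrt (X : set R) (T : R -> R) (F : set R)
  : Prop :=
  [/\ measurable F, (0 < mu F)%E, (mu F < +oo)%E,
      sweeps_out X T F &
      forall A B : set R, measurable A -> measurable B -> A `<=` F -> B `<=` F ->
        (fun n : nat => (\sum_(k < n) muR (A `&` (iter k T @` B))) / a_seq T F n)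
          @ \oo --> (muR A * muR B : R^o)].

End WRE.

(* Main.v *)
Require Import Defs.
From HB Require Import structures.
From mathcomp Require Import all_boot all_order all_algebra.
From mathcomp Require Import all_classical all_reals all_analysis.
From mathcomp Require Import measurable_realfun zify ring lra.
Set Implicit Arguments. Unset Strict Implicit. Unset Printing Implicit Defensive.
Import Order.TTheory GRing.Theory Num.Theory.
Import numFieldNormedType.Exports.
Local Open Scope classical_set_scope.
Local Open Scope ring_scope.

(** Let [Q m = r 0 * ... * r (m-1)] be the number of levels of [C_m] inside
    [F = I], and [S A B n] the sum over [k < n] of [mu (A `&` T^k B)].
    An orbit segment of length at most [h m] visits [F] at most [2 Q m] times,
    while counting pairs of levels gives [Q m * w0 <= 2 * S F F n] for
    [h m <= n]. As [Q (m+1) <= M * Q m], the visits up to time [n] are bounded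
    by a constant multiple of [a_n], uniformly in the starting point, so
    [S A B n / a_n] is dominated by constant multiples of [mu A] and of [mu B].
    Replacing [A] or [B] by its image under [T] changes [S A B n] by a bounded
    amount, and [a_n] tends to infinity, so all levels of [C_m] have the same
    asymptotic share of [S]. This gives the limit first for [A] a level and
    [B = F], then, by domination and a Dynkin-class argument, for every [A] and
    [B = F], and finally, repeating the argument in [B], for all [A] and [B]. *)

(** * Piecewise translations of the line *)

Section PiecewiseTranslations.
Variable R : realType.
Local Notation mu := (@lebesgue_measure R).
Implicit Types (A B C X : set R) (T : R -> R) (c : R).

Lemma image_translation c A : [set x + c | x in A] = (fun x => x - c) @^-1` A.
Proof.
apply/seteqP; split => [_ [x Ax <-]|x Ax] /=; first by rewrite addrK.
by exists (x - c) => //; rewrite subrK.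
Qed.

Lemma measurable_translation c (D : set R) :
  measurable_fun D (fun x : R => x - c).
Proof. exact: measurable_funB. Qed.

Lemma lebesgue_measure_translation c A : measurable A ->
  mu ((fun x => x - c) @^-1` A) = mu A.
Proof.
move=> mA; apply/esym.
have mf : measurable_fun setT ((fun x => x - c) : R -> R).
  exact: measurable_translation.
pose f : {mfun measurableTypeR R >-> measurableTypeR R} :=
  HB.pack ((fun x => x - c) : measurableTypeR R -> measurableTypeR R)
    (isMeasurableFun.Build _ _ (measurableTypeR R) (measurableTypeR R)
       (fun x => x - c) mf).
apply: (@lebesgue_measure_unique R (pushforward mu f)) => // _ [[a b] _ <-] /=.
rewrite /pushforward /=.
have -> : (fun x => x - c) @^-1` `]a, b]%classic = `](a + c), (b + c)]%classic.
  by apply/seteqP; split => x /=; rewrite !in_itv /= ltrBrDr lerBlDr.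
by rewrite !lebesgue_measure_itv /= !lte_fin ltrD2r -!EFinD opprD addrACA subrr addr0.
Qed.

Lemma measurable_image_translation c A : measurable A ->
  measurable [set x + c | x in A].
Proof.
move=> mA; rewrite image_translation -[X in measurable X]setTI.
exact: measurable_translation.
Qed.

Lemma lebesgue_measure_image_translation c A : measurable A ->
  mu [set x + c | x in A] = mu A.
Proof. by move=> mA; rewrite image_translation lebesgue_measure_translation. Qed.

Definition measure_preserving_injection X T :=
  [/\ (forall x y, X x -> X y -> T x = T y -> x = y),
      (forall x, X x -> X (T x)),
      (forall B, measurable B -> B `<=` X ->
         measurable (T @` B) /\ mu (T @` B) = mu B) &
      (forall C, measurable C -> measurable (X `&` T @^-1` C))].

(** Each piece is moved by one translation, which preserves Lebesgue measure, and injectivity keeps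
    the images of disjoint pieces disjoint, so countable additivity applies on both sides. *)
Lemma piecewise_translation_preserving X T (P : nat -> set R) (c : nat -> R) :
  X = \bigcup_i P i -> (forall i, measurable (P i)) ->
  (forall i x, P i x -> T x = x + c i) ->
  (forall x y, X x -> X y -> T x = T y -> x = y) ->
  (forall x, X x -> X (T x)) ->
  measure_preserving_injection X T.
Proof.
move=> XP mP Tc Tinj TX; split => // [B mB BX|C mC].
  (* The pieces [P i] may overlap; [seqDU] makes them disjoint, and [T] is still translation by
     [c i] on the [i]-th one. *)
  pose D i := B `&` seqDU P i.
  have mD i : measurable (D i).
    apply: measurableI => //; apply: measurableD => //; exact: bigsetU_measurable.
  have BD : B = \bigcup_i D i.
    by rewrite -setI_bigcupr -seqDU_bigcup_eq -XP setIidl.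
  have TD i : T @` D i = [set x + c i | x in D i].
    by apply: eq_imagel => x [_ Dx]; apply: Tc; exact: subset_seqDU Dx.
  have tD : trivIset setT D.
    exact/trivIset_setIl/trivIset_seqDU.
  have tTD : trivIset setT (fun i => T @` D i).
    move=> i j _ _ [_ [[x Dx <-] [y Dy /Tinj]]] yx; apply: tD => //.
    exists x; split => //; rewrite -yx//; apply: BX.
    - by case: Dy.
    - by case: Dx.
  have TB : T @` B = \bigcup_i T @` D i by rewrite {1}BD image_bigcup.
  have mTD i : measurable (T @` D i).
    rewrite TD; exact: measurable_image_translation.
  split; first by rewrite TB; exact: bigcupT_measurable.
  rewrite TB [in RHS]BD !measure_bigcup//; [|by move=> i _; exact: mD|by move=> i _; exact: mTD].
  by apply: eq_eseriesr => i _; rewrite TD; exact: lebesgue_measure_image_translation.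
rewrite XP setI_bigcupl; apply: bigcupT_measurable => i.
rewrite (_ : _ `&` _ = P i `&` (fun x => x - - c i) @^-1` C).
  exact: measurable_translation.
by apply/seteqP; split => x [Px /=]; rewrite /= opprK (Tc _ _ Px).
Qed.

Lemma iter_preserving X T k : measurable X ->
  measure_preserving_injection X T ->
  measure_preserving_injection X (iter k T).
Proof.
move=> mX [Tinj TX Tmu Tpre].
elim: k => [|k [Iinj IX Imu Ipre]].
  split => //= [B mB BX|C mC]; last exact: measurableI.
  by rewrite [_ @` B]image_id.
split.
- by move=> x y Xx Xy /= /Tinj E; apply: Iinj => //; apply: E; apply: IX.
- by move=> x Xx /=; apply/TX/IX.
- move=> B mB BX; have [mI eI] := Imu _ mB BX.
  have -> : iter k.+1 T @` B = T @` (iter k T @` B) by rewrite image_comp.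
  have IBX : iter k T @` B `<=` X by move=> _ [x Bx <-]; apply/IX/BX.
  by have [? ->] := Tmu _ mI IBX.
- move=> C /Tpre/Ipre; congr measurable; apply/seteqP; split => x [Xx].
    by case.
  by move=> /= ?; split => //; split => //; apply: IX.
Qed.

Lemma muR_disjointU A B : measurable A -> measurable B ->
  (mu A < +oo)%E -> (mu B < +oo)%E -> A `&` B = set0 ->
  muR (A `|` B) = muR A + muR B.
Proof.
move=> mA mB fA fB AB.
by rewrite /muR measureU// fineD// ge0_fin_numE.
Qed.

Lemma muR_ge0 A : 0 <= muR A.
Proof. exact: fine_ge0. Qed.

Lemma le_muR A B : measurable A -> measurable B -> (mu B < +oo)%E ->
  A `<=` B -> muR A <= muR B.
Proof.
move=> mA mB fB AB; have le : (mu A <= mu B)%E by apply: le_measure; rewrite ?inE.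
by rewrite fine_le// ge0_fin_numE// (le_lt_trans le).
Qed.

(** The sum of the measures is the integral over [A] of the number of [k] with [x] in [G k]. This
    turns pointwise counts of visits into bounds on return sums. *)
Lemma sum_muR_multiplicity_le n (K : nat) A (G : nat -> set R) :
  measurable A -> (mu A < +oo)%E -> (forall k, measurable (A `&` G k)) ->
  (forall x, A x -> (\sum_(k < n) (x \in G k) <= K)%N) ->
  \sum_(k < n) muR (A `&` G k) <= K%:R * muR A.
Proof.
move=> mA fA mG GK.
have fG k : mu (A `&` G k) \is a fin_num.
  rewrite ge0_fin_numE//; apply: le_lt_trans fA.
  by apply: le_measure; rewrite ?inE; [exact: mG|exact: mA|exact: subIsetl].
rewrite -lee_fin EFinM /muR fineK; last by rewrite ge0_fin_numE.
rewrite -sumEFin; under eq_bigr do rewrite fineK//.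
rewrite -integral_cst//.
have intE k : mu (A `&` G k) = (\int[mu]_(x in A) (\1_(A `&` G k) x)%:E)%E.
  by rewrite integral_indic; [rewrite setIAC setIid|exact: mA|exact: mG].
under eq_bigr do rewrite intE.
have mI k : measurable_fun A (fun x => (\1_(A `&` G k) x)%:E : \bar R).
  by apply/measurable_EFinP; apply: measurable_indic; exact: mG.
rewrite -ge0_integral_sum//; last by move=> k; exact: mI.
apply: ge0_le_integral => //.
- by move=> x _; apply: sume_ge0 => k _; rewrite lee_fin.
- by apply: emeasurable_sum => k; exact: mI.
- move=> x Ax; rewrite sumEFin lee_fin.
  under eq_bigr do rewrite indicE in_setI (mem_set Ax) andTb.
  by rewrite -natr_sum ler_nat; exact: GK.
Qed.

End PiecewiseTranslations.

(** * Averaging over cells *)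

Section CellAveraging.
Variable R : realType.
Local Notation mu := (@lebesgue_measure R).

(** Every level of a column turns out to be such an interval, so a level is encoded by one
    integer. *)
Definition cell (w : R) (q : nat) : set R := `[q%:R * w, q%:R * w + w[%classic.

Lemma mu_itvco (a b : R) : a <= b -> mu `[a, b[%classic = (b - a)%:E.
Proof.
move=> ab; rewrite lebesgue_measure_itv /= lte_fin.
by case: ltgtP ab => // -> _; rewrite subrr.
Qed.

Lemma muR_itvco (a b : R) : a <= b -> muR `[a, b[%classic = b - a.
Proof. by move=> ab; rewrite /muR mu_itvco. Qed.

Lemma prefix_cells w k : 0 <= w ->
  `[0, k.+1%:R * w[%classic = `[0, k%:R * w[%classic `|` cell w k.
Proof.
move=> w0; have kw : 0 <= k%:R * w by rewrite mulr_ge0.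
rewrite -[k.+1]addn1 natrD mulrDl mul1r.
apply/seteqP; split => x; rewrite /cell /= !in_itv /=.
  case: (ltP x (k%:R * w)) => xk /andP[x0 xw]; [left|right];
    by apply/andP; split; lra.
by case=> /andP[? ?]; apply/andP; split; lra.
Qed.

Lemma prefix_cell_disjoint w k : `[0, k%:R * w[%classic `&` cell w k = set0.
Proof.
apply/seteqP; split => x //= []; rewrite /cell /= !in_itv /= => /andP[_ ?] /andP[? _].
by lra.
Qed.

Variables (w0 C beta : R) (Q : nat -> nat) (phi : nat -> set R -> R).
Let F : set R := `[0, w0[%classic.
Let w m : R := w0 / (Q m)%:R.

Hypothesis w0_gt0 : 0 < w0.
Hypothesis C_ge0 : 0 <= C.
Hypothesis Q_gt0 : forall m, (0 < Q m)%N.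
Hypothesis Q_unbounded : forall N : nat, exists m, (N <= Q m)%N.
Hypothesis phiU : forall n A B, measurable A -> measurable B ->
  A `<=` F -> B `<=` F -> A `&` B = set0 -> phi n (A `|` B) = phi n A + phi n B.
Hypothesis phi_ge0 : forall n A, 0 <= phi n A.
Hypothesis phi_le : forall n A, measurable A -> A `<=` F -> phi n A <= C * muR A.
Hypothesis phiF : phi n F @[n --> \oo] --> beta * w0.
Hypothesis phi_cell : forall m q, (q < Q m)%N ->
  (phi n (cell (w m) q) - phi n (cell (w m) 0)) @[n --> \oo] --> (0 : R).

Let w_gt0 m : 0 < w m. Proof. by rewrite divr_gt0// ltr0n. Qed.

Let Qw m : (Q m)%:R * w m = w0.
Proof. by rewrite /w mulrC divfK// pnatr_eq0 -lt0n. Qed.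

Let mF : measurable F. Proof. exact: measurable_itv. Qed.

Let muF_lty A : measurable A -> A `<=` F -> (mu A < +oo)%E.
Proof.
move=> mA AF; apply: (@le_lt_trans _ _ (mu F)).
  by apply: le_measure; rewrite ?inE.
by rewrite mu_itvco ?ltry// ltW.
Qed.

Let phi0 n : phi n set0 = 0.
Proof.
have := @phiU n set0 set0 measurable0 measurable0 (@sub0set _ _) (@sub0set _ _).
by rewrite setI0 setU0 => /(_ erefl) /eqP; rewrite -subr_eq0 opprD addNKr oppr_eq0 => /eqP.
Qed.

Let prefixF m k : (k <= Q m)%N -> `[0, k%:R * w m[%classic `<=` F.
Proof.
move=> kQ x /=; rewrite /F /= !in_itv /= => /andP[-> /lt_le_trans]; apply.
by rewrite -(Qw m) ler_wpM2r ?ler_nat// ltW.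
Qed.

Let cellF m k : (k < Q m)%N -> cell (w m) k `<=` F.
Proof.
move=> kQ; apply: subset_trans (prefixF kQ).
by rewrite prefix_cells ?ltW//; exact: subsetUr.
Qed.

Let phi_prefix n m k : (k <= Q m)%N ->
  phi n `[0, k%:R * w m[%classic = \sum_(i < k) phi n (cell (w m) i).
Proof.
elim: k => [_|k IH kQ]; first by rewrite mul0r set_itvco0 big_ord0.
rewrite prefix_cells ?(ltW (w_gt0 m))// phiU.
- by rewrite IH 1?ltnW// big_ord_recr.
- exact: measurable_itv.
- exact: measurable_itv.
- by apply: prefixF; exact: ltnW.
- exact: cellF.
- exact: prefix_cell_disjoint.
Qed.

(** The [Q m] cells partition [F] and have asymptotically equal values, so each receives the
    fraction [1 / Q m] of the limit [beta * w0]. *)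
Let phi_cell0_cvg m : phi n (cell (w m) 0) @[n --> \oo] --> beta * w m.
Proof.
have Q0 : (Q m)%:R != 0 :> R by rewrite pnatr_eq0 -lt0n.
have -> : beta * w m = (Q m)%:R^-1 * (beta * w0 - \sum_(i < Q m) 0).
  by rewrite big1// subr0 /w; field.
have -> : (fun n => phi n (cell (w m) 0)) = (fun n => (Q m)%:R^-1 *
   (phi n F - \sum_(i < Q m) (phi n (cell (w m) i) - phi n (cell (w m) 0)))).
  apply/funext => n; rewrite /F -(Qw m) phi_prefix// sumrB opprB addrC subrK.
  by rewrite sumr_const card_ord -[X in _ * X]mulr_natl mulKf.
apply: cvgM; first exact: cvg_cst.
apply: cvgB => //; apply: cvg_big => [|i _]; [exact: add_continuous|]; exact: phi_cell.
Qed.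

Let phi_cell_cvg m q : (q < Q m)%N ->
  phi n (cell (w m) q) @[n --> \oo] --> beta * w m.
Proof.
move=> qQ; rewrite -[beta * w m]add0r.
have -> : (fun n => phi n (cell (w m) q)) = (fun n =>
  (phi n (cell (w m) q) - phi n (cell (w m) 0)) + phi n (cell (w m) 0)).
  by apply/funext => n; rewrite subrK.
by apply: cvgD; [exact: phi_cell|exact: phi_cell0_cvg].
Qed.

Let converges A := phi n A @[n --> \oo] --> beta * muR A.

Let prefix_converges m k : (k <= Q m)%N -> converges `[0, k%:R * w m[%classic.
Proof.
move=> kQ; rewrite /converges muR_itvco; last by rewrite mulr_ge0// ltW.
have -> : (fun n => phi n `[0, k%:R * w m[%classic) =
          (fun n => \sum_(i < k) phi n (cell (w m) i)).
  by apply/funext => n; exact: phi_prefix.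
have -> : beta * (k%:R * w m - 0) = \sum_(i < k) beta * w m.
  by rewrite sumr_const card_ord subr0 -[RHS]mulr_natl mulrCA.
apply: cvg_big => [|i _]; [exact: add_continuous|]; apply: phi_cell_cvg; exact: leq_trans kQ.
Qed.

Let muR_split A B : measurable A -> measurable B -> A `<=` F -> B `<=` A ->
  muR A = muR B + muR (A `\` B).
Proof.
move=> mA mB AF BA; have mD : measurable (A `\` B) by exact: measurableD.
rewrite -[in LHS](setDUK BA) muR_disjointU ?setDIK//; apply: muF_lty => //.
  exact: subset_trans AF.
by apply: subset_trans AF; exact: subDsetl.
Qed.

Let phi_split n A B : measurable A -> measurable B -> A `<=` F -> B `<=` A ->
  phi n A = phi n B + phi n (A `\` B).
Proof.
move=> mA mB AF BA; have mD : measurable (A `\` B) by exact: measurableD.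
rewrite -[in LHS](setDUK BA) phiU ?setDIK//; first exact: subset_trans AF.
by apply: subset_trans AF; exact: subDsetl.
Qed.

(** Domination bounds [phi n (A]\[B)] by [C] times the measure of [A]\[B], uniformly in [n], so
    convergence passes from inner approximations to [A]. *)
Let converges_approx A : measurable A -> A `<=` F ->
  (forall e : R, 0 < e -> exists B, [/\ measurable B, B `<=` A, converges B &
     muR (A `\` B) <= e]) -> converges A.
Proof.
move=> mA AF approx; apply/cvgrPdist_le => e e0.
(* The errors on [A]\[B] then total at most [e / 2], the other half being left for [B]; the summand
   1 keeps the denominator positive. *)
pose d := e / (2 * (C + `|beta| + 1)).
have M0 : 0 < C + `|beta| + 1 by rewrite ltr_wpDl// addr_ge0.
have d0 : 0 < d by rewrite divr_gt0// mulr_gt0.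
have [B [mB BA cB AB]] := approx _ d0.
have e20 : 0 < e / 2 by lra.
move/cvgrPdist_le : cB => /(_ _ e20); apply: filterS => n.
rewrite (@muR_split A B)// (@phi_split n A B)//.
have D0 := muR_ge0 (A `\` B); have P0 := phi_ge0 n (A `\` B).
have mAB : measurable (A `\` B) by exact: measurableD.
have PC : phi n (A `\` B) <= C * muR (A `\` B).
  by apply: phi_le => //; apply: subset_trans AF; exact: subDsetl.
have Cd : C * muR (A `\` B) <= C * d by rewrite ler_wpM2l.
have bd : `|beta * muR (A `\` B)| <= `|beta| * d.
  by rewrite normrM (ger0_norm D0) ler_wpM2l.
have dE : C * d + `|beta| * d + d = e / 2.
  by rewrite -[X in _ + X]mul1r -!mulrDl /d; field; rewrite gt_eqF.
rewrite mulrDr !ler_norml; move: bd; rewrite ler_norml => /andP[b1 b2].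
by move=> /andP[h1 h2]; clearbody d; apply/andP; split; lra.
Qed.

(** Inside [F] a ray is empty, all of [F], or [[0, a[]; the last is filled from the left by whole
    cells up to an error of one cell width. *)
Let converges_ray a : converges (`]-oo, a[%classic `&` F).
Proof.
have [a0|a0] := leP a 0.
  have -> : `]-oo, a[%classic `&` F = set0.
    by apply/seteqP; split => x //= []; rewrite /F /= !in_itv /= => ? /andP[]; lra.
  rewrite /converges /muR measure0 mulr0.
  by under eq_fun do rewrite phi0; exact: cvg_cst.
have [aw|aw] := leP w0 a.
  have -> : `]-oo, a[%classic `&` F = F.
    by apply/seteqP; split => x //=; rewrite /F /= !in_itv /=; [case|move=> /andP[]; split; lra].
  by rewrite /converges muR_itvco ?subr0//; exact: ltW.
have -> : `]-oo, a[%classic `&` F = `[0, a[%classic.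
  apply/seteqP; split => x /=; rewrite /F /= !in_itv /=.
    by case=> -> /andP[->].
  by move=> /andP[-> xa]; split => //=; lra.
have aF : `[0, a[%classic `<=` F.
  by move=> x /=; rewrite /F /= !in_itv /= => /andP[-> ?]; lra.
apply: converges_approx => // e e0.
(* This [m] makes a cell at most [e] wide; [k] below is the number of whole cells that fit in [[0,
   a[]. *)
have [m Qm] := Q_unbounded (Num.truncn (w0 / e)).+1.
have we : w m <= e.
  rewrite /w ler_pdivrMr ?ltr0n// mulrC -ler_pdivrMr//.
  apply: ltW; apply: lt_le_trans (truncnS_gt _) _; by rewrite ler_nat.
pose k := Num.truncn (a / w m).
have aw0 : 0 <= a / w m by rewrite divr_ge0// ltW.
have /andP[k1 k2] := truncn_itv aw0.
have ka : k%:R * w m <= a by rewrite -ler_pdivlMr.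
have ak : a < k%:R * w m + w m.
  by move: k2; rewrite ltr_pdivrMr// -addn1 natrD mulrDl mul1r.
have kQ : (k <= Q m)%N.
  rewrite -(ler_nat R) -(ler_pM2r (w_gt0 m)) Qw; exact: (le_trans ka (ltW aw)).
exists `[0, k%:R * w m[%classic; split => //.
- by move=> x /=; rewrite !in_itv /= => /andP[-> /lt_le_trans]; apply.
- exact: prefix_converges.
- have kw0 : 0 <= k%:R * w m by rewrite mulr_ge0// ltW.
  have sub : `[0, k%:R * w m[%classic `<=` `[0, a[%classic.
    by move=> x /=; rewrite !in_itv /= => /andP[-> /lt_le_trans]; apply.
  have := @muR_split `[0, a[%classic `[0, k%:R * w m[%classic
    (measurable_itv _) (measurable_itv _) aF sub.
  rewrite (muR_itvco (ltW a0)) (muR_itvco kw0).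
  move: ak we; move: (k%:R * w m) (muR _) => ? ?; lra.
Qed.

Let phi_bigU (A : nat -> set R) : (forall k, measurable (A k)) ->
  (forall k, A k `<=` F) -> trivIset setT A ->
  (forall k, converges (A k)) ->
  forall N, converges (\big[setU/set0]_(k < N) A k).
Proof.
move=> mA AF tA cA; elim=> [|N IH].
  rewrite big_ord0 /converges /muR measure0 mulr0.
  by under eq_fun do rewrite phi0; exact: cvg_cst.
have mB : measurable (\big[setU/set0]_(k < N) A k) by exact: bigsetU_measurable.
have BF : \big[setU/set0]_(k < N) A k `<=` F.
  by move=> x; rewrite -bigcup_mkord => -[i _ /AF].
have dis : \big[setU/set0]_(k < N) A k `&` A N = set0.
  apply/seteqP; split => x //=; rewrite -bigcup_mkord => -[[i /= iN Ai] AN].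
  have := tA i N I I; move=> /(_ (ex_intro _ x (conj Ai AN))) iE.
  by move: iN; rewrite iE ltnn.
rewrite /converges big_ord_recr /= muR_disjointU ?mulrDr//; [|exact: muF_lty..].
under eq_fun do rewrite phiU//.
by apply: cvgD; [exact: IH|exact: cA].
Qed.

(** Cells give initial segments of [F], these give rays, and rays form a generating pi-system. The
    functional [phi] is kept abstract because the result is applied twice: to the first argument of
    the return sums with [beta = w0], then to the second with [beta = muR A]. *)
Lemma cell_averaging A : measurable A -> A `<=` F ->
  phi n A @[n --> \oo] --> beta * muR A.
Proof.
move=> mA AF; rewrite -(setIidl AF).
have cF : converges F by rewrite /converges muR_itvco ?subr0// ltW.
(* The induction runs over Borel sets of the whole line, each tested through its trace on [F]. *)
apply: (@dynkin_induction _ (measurableTypeR R) (@RGenInftyO.G R)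
          (fun A => converges (A `&` F))).
- exact: RGenInftyO.measurableE.
- move=> _ _ [x ->] [y ->]; exists (Num.min x y).
  by apply/seteqP; split => z /=; rewrite !in_itv /= lt_min => /andP.
- by rewrite setTI.
- by move=> _ [x ->]; exact: converges_ray.
- move=> S mS cS; have mSF : measurable (S `&` F) by exact: measurableI.
  have E : ~` S `&` F = F `\` (S `&` F).
    by rewrite setIC -setDE setDIr setDv setU0.
  have SF : S `&` F `<=` F by exact: subIsetr.
  have FE := @muR_split F (S `&` F) mF mSF (@subset_refl _ _) SF.
  rewrite /converges E.
  have -> : muR (F `\` (S `&` F)) = muR F - muR (S `&` F) by rewrite FE addrC addKr.
  rewrite mulrBr.
  have -> : (fun n => phi n (F `\` (S `&` F))) =
            (fun n => phi n F - phi n (S `&` F)).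
    by apply/funext => n; rewrite (@phi_split n F (S `&` F))// addrC addKr.
  exact: cvgB.
- move=> G mG tG cG; rewrite setI_bigcupl.
  have mGF k : measurable (G k `&` F) by exact: measurableI.
  have GF k : G k `&` F `<=` F by exact: subIsetr.
  have tGF : trivIset setT (fun k => G k `&` F) by exact: trivIset_setIr.
  have mU : measurable (\bigcup_i (G i `&` F)) by exact: bigcupT_measurable.
  have UF : \bigcup_i (G i `&` F) `<=` F by exact: bigcup_sub.
  apply: converges_approx => // e e0.
  (* Since [phi] is only finitely additive, the countable union is approximated from inside by
     finite ones, using continuity of the measure from below. *)
  pose B N := \big[setU/set0]_(k < N.+1) (G k `&` F).
  have mB N : measurable (B N) by exact: bigsetU_measurable.
  have BU N : B N `<=` \bigcup_i (G i `&` F) by exact: bigsetU_bigcup.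
  have : mu (B N) @[N --> \oo] --> mu (\bigcup_i (G i `&` F)).
    rewrite -bigcup_bigsetU_bigcup.
    apply: (@nondecreasing_cvg_mu _ _ _ mu B mB); first exact: bigcupT_measurable.
    move=> i j ij; apply/subsetPset.
    exact: (@subset_bigsetU _ (fun k => G k `&` F) i.+1 j.+1).
  rewrite -[X in _ --> X]fineK; last by rewrite ge0_fin_numE//; exact: muF_lty.
  move=> /fine_cvg /cvgrPdist_le /(_ _ e0) [N _ /(_ N (leqnn N)) /=].
  rewrite -/(muR _) -/(muR (B N)) => BN; exists (B N); split.
  - exact: mB.
  - exact: BU.
  - exact: (phi_bigU mGF GF tGF cG).
  - move: BN; rewrite (muR_split mU (mB N) UF (BU N)) addrC addKr ger0_norm//.
    exact: muR_ge0.
- have <- : @measurable _ (measurableTypeR R) = <<s @RGenInftyO.G R >>.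
    exact: RGenInftyO.measurableE.
  exact: mA.
Qed.

End CellAveraging.

(** * Combinatorics of the columns *)

Section Cells.
Variable R : realType.

Lemma cellP (w : R) q x : 0 < w ->
  cell w q x <-> 0 <= x /\ Num.truncn (x / w) = q.
Proof.
move=> w0; have wge0 := ltW w0.
have E : q.+1%:R * w = q%:R * w + w by rewrite -addn1 natrD mulrDl mul1r.
rewrite /cell /= in_itv /= -E -ler_pdivlMr// -ltr_pdivrMr//; split.
  move=> /andP[qx xq]; split; last by apply: truncn_def; rewrite qx xq.
  by have := le_trans (ler0n _ _) qx; rewrite pmulr_lge0// invr_gt0.
by case=> x0 <-; apply: truncn_itv; rewrite divr_ge0.
Qed.

Lemma cell_uniq (w : R) p q x : 0 < w -> cell w p x -> cell w q x -> p = q.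
Proof. by move=> w0 /(cellP _ _ w0)[_ <-] /(cellP _ _ w0)[_ <-]. Qed.

Lemma cell_prefixP (w : R) h x : 0 < w -> `[0, h%:R * w[%classic x <->
  exists2 q, (q < h)%N & cell w q x.
Proof.
move=> w0; split => [/=|[q qh]].
  rewrite in_itv /= => /andP[x0 xh]; exists (Num.truncn (x / w)).
    rewrite -(ltr_nat R) (le_lt_trans _ (_ : x / w < _)) ?ltr_pdivrMr//.
    by rewrite truncn_le// divr_ge0// ltW.
  exact/(cellP _ _ w0).
rewrite /cell /= !in_itv /= => /andP[qx xq]; apply/andP; split.
  by apply: le_trans qx; rewrite mulr_ge0// ltW.
apply: lt_le_trans xq _.
by rewrite -[X in _ + X]mul1r -mulrDl natr1 ler_pM2r// ler_nat.
Qed.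

(** Cutting cell [p] into [r] equal slices gives the narrower cells numbered [r * p + i]; this is
    the numbering that [level_index] follows. *)
Lemma cell_split (w : R) r p x : 0 < w -> (0 < r)%N -> cell (r%:R * w) p x ->
  exists2 i, (i < r)%N & cell w (r * p + i)%N x.
Proof.
move=> w0 r0; rewrite /cell /= in_itv /= => /andP[px xp].
have x0 : 0 <= x by apply: le_trans px; rewrite !mulr_ge0// ltW.
pose q := Num.truncn (x / w).
have cq : cell w q x by exact/(cellP _ _ w0).
have := cq; rewrite /cell /= in_itv /= => /andP[qx xq].
have pq : (r * p < q.+1)%N.
  rewrite -(ltr_nat R) -(ltr_pM2r w0); apply: le_lt_trans (_ : x < _).
    by rewrite natrM -mulrA mulrCA.
  by rewrite -natr1 mulrDl mul1r.
have qp : (q < r * p.+1)%N.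
  rewrite -(ltr_nat R) -(ltr_pM2r w0); apply: le_lt_trans qx _.
  by rewrite natrM -natr1 mulrDr mulr1 mulrDl [_ * p%:R]mulrC -mulrA.
exists (q - r * p)%N; first by rewrite mulnS in qp; lia.
by rewrite subnKC.
Qed.

End Cells.

(** * Heights of the columns and numbering of their levels *)

Section Combinatorics.
Variables (r : nat -> nat) (s : nat -> nat -> nat).
Hypothesis r_ge2 : forall n, (2 <= r n)%N.
Local Notation h := (ro_height r s).
Local Notation sub := (subpos r s).

Lemma subposS n i : sub n i.+1 = (sub n i + h n + s n i)%N.
Proof. by rewrite /subpos big_ord_recr /=; lia. Qed.

Lemma subpos0 n : sub n 0 = 0%N.
Proof. by rewrite /subpos big_ord0. Qed.

Lemma subpos_last n : sub n (r n) = h n.+1.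
Proof. by []. Qed.

Lemma leq_subpos n i j : (i <= j)%N -> (sub n i <= sub n j)%N.
Proof.
elim: j => [|j IH]; first by rewrite leqn0 => /eqP->.
rewrite leq_eqVlt ltnS => /predU1P[->//|/IH].
by rewrite subposS; lia.
Qed.

Lemma height_gt0 n : (0 < h n)%N.
Proof. by elim: n => //= n IH; have := r_ge2 n; nia. Qed.

Lemma height_double n : (2 * h n <= h n.+1)%N.
Proof. by have := r_ge2 n; rewrite /=; nia. Qed.

Lemma height_unbounded N : exists n, (N < h n)%N.
Proof.
exists N; elim: N => // N IH; have := height_double N; have := height_gt0 N; lia.
Qed.

Lemma cuts_gt0 n : (0 < \prod_(k < n) r k)%N.
Proof. by apply: prodn_gt0 => k; exact: leq_trans (r_ge2 k). Qed.

Lemma cuts_ge n : (n < \prod_(k < n) r k)%N.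
Proof.
elim: n => [|n IH]; first by rewrite big_ord0.
by rewrite big_ord_recr /=; have := r_ge2 n; move: (\prod_(k < n) r k)%N IH; nia.
Qed.

Lemma cuts_le_height n : (\prod_(k < n) r k <= h n)%N.
Proof.
elim: n => [|n IH]; first by rewrite big_ord0.
by rewrite big_ord_recr /=; have := r_ge2 n; move: (\prod_(k < n) r k)%N IH; nia.
Qed.

Lemma find_subcolumn n i j : (i < r n)%N -> (sub n i <= j < sub n i.+1)%N ->
  find (fun i => (j < sub n i.+1)%N) (iota 0 (r n)) = i.
Proof.
move=> ir /andP[ij ji]; set a := (fun _ => _).
have hasa : has a (iota 0 (r n)) by apply/hasP; exists i; rewrite ?mem_iota.
have := nth_find 0%N hasa; move: hasa; rewrite has_find size_iota => fr.
rewrite nth_iota// add0n /a => jf.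
have [fi|fi|//] := ltngtP (find a (iota 0 (r n))) i.
  by have := leq_subpos n fi; rewrite -/a in jf; lia.
by have := before_find 0%N fi; rewrite nth_iota ?(ltn_trans fi)// add0n /a ji.
Qed.

(** The recursion of [left_end] with lengths counted in units of the width of [C_n]: the horizontal
    position of level [j]. Slices of old levels come first, the new spacers after them. *)
Fixpoint level_index (n j : nat) : nat :=
  match n with
  | 0 => 0
  | n'.+1 =>
      let i := find (fun i => (j < sub n' i.+1)%N) (iota 0 (r n')) in
      if (j < sub n' i + h n')%N
      then (r n' * level_index n' (j - sub n' i) + i)%N
      else (r n' * h n' + ((\sum_(l < i) s n' l) + (j - sub n' i - h n')))%N
  end.

Lemma level_index_subcolumn n i j : (i < r n)%N -> (j < h n)%N ->
  level_index n.+1 (sub n i + j) = (r n * level_index n j + i)%N.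
Proof.
move=> ir jh; rewrite [LHS]/= (@find_subcolumn n i) ?ltn_add2l ?jh ?addKn//.
by rewrite subposS; lia.
Qed.

Lemma level_index_spacer n i t : (i < r n)%N -> (t < s n i)%N ->
  level_index n.+1 (sub n i + h n + t) =
  (r n * h n + (\sum_(l < i) s n l + t))%N.
Proof.
move=> ir ts; rewrite [LHS]/= (@find_subcolumn n i) ?ifF//; last 2 first.
- by lia.
- by rewrite subposS; lia.
by rewrite -addnA addKn addKn.
Qed.

Lemma level_index_surj n q : (q < h n)%N ->
  exists2 j, (j < h n)%N & level_index n j = q.
Proof.
elim: n q => [|n IH] q qh; first by exists 0%N => //; case: q qh.
have r0 : (0 < r n)%N by have := r_ge2 n; lia.
have [qr|rq] := ltnP q (r n * h n).
  have [j jh jq] := IH (q %/ r n)%N ltac:(by rewrite ltn_divLR// mulnC).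
  have ir : (q %% r n < r n)%N by rewrite ltn_mod.
  exists (sub n (q %% r n) + j)%N.
    by have := leq_subpos n ir; rewrite subposS subpos_last; lia.
  by rewrite level_index_subcolumn// jq mulnC -divn_eq.
have : (q - r n * h n < \sum_(l < r n) s n l)%N.
  by rewrite ltn_subLR.
(* Locates the [t]-th new spacer: it is number [u] above subcolumn [i]. *)
have : forall k t, (t < \sum_(l < k) s n l)%N -> exists i u,
    [/\ (i < k)%N, (u < s n i)%N & t = (\sum_(l < i) s n l + u)%N].
  elim=> [t|k IHk t]; first by rewrite big_ord0.
  rewrite big_ord_recr /=.
  case: (ltnP t (\sum_(l < k) s n l)%N) => [/IHk[i [u [ik us tE]]] _|kt tk].
    by exists i, u; split => //; exact: ltnW.
  by exists k, (t - \sum_(l < k) s n l)%N; rewrite ltn_subLR// subnKC.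
move=> /[apply] -[i [u [ir us qE]]]; exists (sub n i + h n + u)%N.
  by have := leq_subpos n ir; rewrite subposS subpos_last; lia.
by rewrite level_index_spacer// -qE subnKC.
Qed.

(** A choice of preimages under a surjection of a finite set to itself is injective, hence a
    permutation. Bounds, injectivity and cardinalities for [level_index] are all read off from
    it. *)
Lemma level_index_bij n : exists g : 'I_(h n) -> 'I_(h n), bijective g /\
  forall q, level_index n (g q) = q.
Proof.
have H (q : 'I_(h n)) : exists j : 'I_(h n), level_index n j == q.
  by have [j jh jq] := level_index_surj (ltn_ord q); exists (Ordinal jh); rewrite jq.
pose g q := xchoose (H q); have gP q : level_index n (g q) = q.
  exact/eqP/(xchooseP (H q)).
exists g; split => //; apply: injF_bij => p q /(congr1 (level_index n \o val)) /=.
by rewrite !gP => /val_inj.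
Qed.

Lemma level_index_lt n j : (j < h n)%N -> (level_index n j < h n)%N.
Proof.
have [g [[g' _ gK] gP]] := level_index_bij n; move=> jh.
by have := gP (g' (Ordinal jh)); rewrite gK /= => ->.
Qed.

Lemma level_index_inj n i j : (i < h n)%N -> (j < h n)%N ->
  level_index n i = level_index n j -> i = j.
Proof.
have [g [[g' _ gK] gP]] := level_index_bij n; move=> ih jh.
have := gP (g' (Ordinal ih)); have := gP (g' (Ordinal jh)).
rewrite !gK /= => -> -> /val_inj /(congr1 g); rewrite !gK.
by case.
Qed.

Lemma level_index0 n : level_index n 0 = 0%N.
Proof.
elim: n => // n IH; have r0 : (0 < r n)%N by have := r_ge2 n; lia.
have := level_index_subcolumn r0 (height_gt0 n).
by rewrite subpos0 add0n IH muln0.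
Qed.

(** For [Q] the product of the first [n] cuts, this counts the levels of [C_n] contained in [I]. *)
Lemma card_level_index_lt n Q : (Q <= h n)%N ->
  #|[set j : 'I_(h n) | (level_index n j < Q)%N]%SET| = Q.
Proof.
have [g [gb gP]] := level_index_bij n; move=> Qh.
rewrite -(card_preimset _ (bij_inj gb)).
rewrite (_ : _ @^-1: _ = [set widen_ord Qh i | i in 'I_Q]%SET).
  by rewrite card_imset ?card_ord// => i j /(congr1 val) /= /val_inj.
apply/setP => q; rewrite !inE gP; apply/idP/imsetP => [qQ|[i _ ->]]; last by rewrite /= ltn_ord.
by exists (Ordinal qQ) => //; apply: val_inj.
Qed.

End Combinatorics.

(** * The rank-one map *)

Section RankOneMap.
Variables (R : realType) (w0 : R) (r : nat -> nat) (s : nat -> nat -> nat).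
Hypothesis w0_gt0 : 0 < w0.
Hypothesis r_ge2 : forall n, (2 <= r n)%N.
Local Notation h := (ro_height r s).
Local Notation sub := (subpos r s).
Local Notation w := (ro_width w0 r).
Local Notation L := (left_end w0 r s).
Local Notation level := (ro_level w0 r s).
Local Notation X := (ro_space w0 r s).
Local Notation T := (rank_one_map w0 r s).
Local Notation idx := (level_index r s).

Lemma width_gt0 n : 0 < w n.
Proof. by rewrite divr_gt0// ltr0n cuts_gt0. Qed.

Lemma widthS n : w n = (r n)%:R * w n.+1.
Proof.
rewrite /ro_width big_ord_recr /= natrM.
have r0 : (r n)%:R != 0 :> R by rewrite pnatr_eq0 -lt0n; exact: ltnW.
have p0 : (\prod_(k < n) r k)%:R != 0 :> R by rewrite pnatr_eq0 -lt0n cuts_gt0.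
by field; rewrite r0 p0.
Qed.

Lemma left_endE n j : L n j = (idx n j)%:R * w n.
Proof.
elim: n j => [|n IH] j; first by rewrite mul0r.
rewrite [LHS]/= [idx _ _]/=; case: ifP => _.
  by rewrite IH (widthS n) natrD natrM; ring.
by rewrite (widthS n) [in RHS]natrD natrM; ring.
Qed.

Lemma levelE n j : level n j = cell (w n) (idx n j).
Proof. by rewrite /ro_level /cell left_endE. Qed.

Lemma measurable_level n j : measurable (level n j).
Proof. exact: measurable_itv. Qed.

Lemma level_uniq n i j x : (i < h n)%N -> (j < h n)%N ->
  level n i x -> level n j x -> i = j.
Proof.
rewrite !levelE => ih jh /(cell_uniq (width_gt0 n)) + jx => /(_ _ jx).
exact: level_index_inj.
Qed.

Lemma spaceP x : X x <-> exists n j, (j < h n)%N /\ level n j x.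
Proof.
split=> [[n _ /(cell_prefixP _ _ (width_gt0 n))[q qh]]|[n [j [jh]]]].
  have [j jh <-] := level_index_surj r_ge2 qh; rewrite -levelE.
  by exists n, j.
rewrite levelE => jx; exists n => //; apply/(cell_prefixP _ _ (width_gt0 n)).
by exists (idx n j) => //; exact: level_index_lt.
Qed.

Lemma left_end_subcolumn n i j : (i < r n)%N -> (j < h n)%N ->
  L n.+1 (sub n i + j) = L n j + i%:R * w n.+1.
Proof.
move=> ir jh; rewrite !left_endE level_index_subcolumn// natrD natrM (widthS n).
by ring.
Qed.

Lemma level_subcolumn n j x : (j < h n)%N -> level n j x ->
  exists2 i, (i < r n)%N & level n.+1 (sub n i + j) x.
Proof.
move=> jh; rewrite levelE widthS.
move=> /(cell_split (width_gt0 n.+1) (ltnW (r_ge2 n)))[i ir ix].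
by exists i => //; rewrite levelE level_index_subcolumn.
Qed.

(** A copy of [C_n] sits in [C_N] as a block of consecutive levels starting at [p], and [x] selects
    the copy. A single shift [d] serves the whole block, so steps between levels agree in both
    columns. *)
Lemma level_refine n N j x : (n <= N)%N -> (j < h n)%N -> level n j x ->
  exists p d, [/\ (p + h n <= h N)%N, level N (p + j) x &
    forall j', (j' < h n)%N -> L N (p + j') = L n j' + d].
Proof.
move=> + jh jx; elim: N => [|N IH].
  rewrite leqn0 => /eqP n0; subst n; exists 0%N, 0.
  by split => [||j' _]; rewrite ?add0n ?addr0.
rewrite leq_eqVlt ltnS => /predU1P[<-|/IH[p [d [pN px pd]]]].
  by exists 0%N, 0; split => [||j' _]; rewrite ?add0n ?addr0.
have pjN : (p + j < h N)%N by lia.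
have [i ir ix] := level_subcolumn pjN px.
exists (sub N i + p)%N, (d + i%:R * w N.+1); split.
- have := leq_subpos r s N ir; rewrite subposS subpos_last; lia.
- by rewrite -addnA.
- move=> j' jh'; rewrite -addnA left_end_subcolumn ?pd ?addrA//; lia.
Qed.

(** * Action of the map on levels *)

Lemma level_translate n i j x : level n i x -> level n j (x + (L n j - L n i)).
Proof. by rewrite /ro_level /= !in_itv /= => /andP[? ?]; apply/andP; split; lra. Qed.

(** The map is defined through an arbitrarily chosen level containing [x]. In a common refinement,
    that level and level [j] of [C_n] become the same level, so both prescribe the same
    translation. *)
Lemma T_level n j x : (j.+1 < h n)%N -> level n j x ->
  T x = x + (L n j.+1 - L n j).
Proof.
move=> jh jx; rewrite /rank_one_map; case: pselect => [H|[]]; last by exists (n, j).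
case: (projT2 (cid H)); set nj := projT1 _ => jh' jx'; congr (_ + _).
have [p [d [pN px pd]]] := level_refine (leq_maxl n nj.1) (ltnW jh) jx.
have [p' [d' [pN' px' pd']]] := level_refine (leq_maxr n nj.1) (ltnW jh') jx'.
have E : (p + j = p' + nj.2)%N by apply: level_uniq px px' => //; lia.
have := pd _ jh; have := pd _ (ltnW jh); have := pd' _ jh'; have := pd' _ (ltnW jh').
by rewrite !addnS E => -> -> e1 e2; lra.
Qed.

Lemma T_level_up n j x : (j.+1 < h n)%N -> level n j x -> level n j.+1 (T x).
Proof. by move=> jh jx; rewrite (T_level jh jx); exact: level_translate. Qed.

Lemma iter_level n j k x : (j + k < h n)%N -> level n j x ->
  iter k T x = x + (L n (j + k) - L n j).
Proof.
elim: k => [|k IH] jk jx; first by rewrite addn0 subrr addr0.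
have jk' : (j + k < h n)%N by lia.
rewrite iterS (IH jk' jx) addnS (@T_level n (j + k)); [by lra|by lia|].
exact: level_translate jx.
Qed.

Lemma iter_level_up n j k x : (j + k < h n)%N -> level n j x ->
  level n (j + k) (iter k T x).
Proof. by move=> jk jx; rewrite (iter_level jk jx); exact: level_translate. Qed.

Lemma iter_level_image n j k : (j + k < h n)%N ->
  iter k T @` level n j = level n (j + k).
Proof.
move=> jk; apply/seteqP; split => [_ [x jx <-]|x jx]; first exact: iter_level_up.
exists (x + (L n j - L n (j + k))); first exact: level_translate jx.
by rewrite (iter_level jk); [lra|exact: level_translate jx].
Qed.

(* A top level is cut from left to right, and its part that is still on top is
   the last, right-most slice. Intervals being right-open, no point stays in
   the top levels forever. *)
Lemma not_top_or_right_end n j x k : (j < h n)%N -> level n j x ->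
  (exists n' j', (j'.+1 < h n')%N /\ level n' j' x) \/
  (exists j', [/\ (j' < h (n + k))%N, level (n + k) j' x &
     L (n + k) j' + w (n + k) = L n j + w n]).
Proof.
move=> jh jx; elim: k => [|k [IH|[j' [jh' jx' jE]]]].
- by right; exists j; rewrite addn0.
- by left.
have [i ir ix] := level_subcolumn jh' jx'.
have iN := leq_subpos r s (n + k) ir; rewrite subposS subpos_last in iN.
case: (ltnP (sub (n + k) i + j').+1 (h (n + k).+1)) => top.
  by left; exists (n + k).+1, (sub (n + k) i + j')%N.
right; exists (sub (n + k) i + j')%N; rewrite addnS; split => //; first by lia.
rewrite left_end_subcolumn// -jE (widthS (n + k)).
have -> : r (n + k) = i.+1.
  apply/eqP; rewrite eqn_leq ir andbT leqNgt; apply/negP => ir'.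
  have := leq_subpos r s (n + k) ir'.
  rewrite !subposS subpos_last; have := height_gt0 s r_ge2 (n + k); lia.
by rewrite -natr1; ring.
Qed.

Lemma below_top x : X x -> exists n j, (j.+1 < h n)%N /\ level n j x.
Proof.
move=> /spaceP[n [j [jh jx]]].
(* The distance from [x] to the right end of its level. Once the width of [C_(n + k)] is below [e],
   no level with this right end contains [x]. *)
pose e := L n j + w n - x.
have e0 : 0 < e.
  by move: jx; rewrite /ro_level /= in_itv /= => /andP[_]; rewrite subr_gt0.
pose k := (Num.truncn (w0 / e)).+1.
have we : w (n + k) < e.
  rewrite /ro_width ltr_pdivrMr ?ltr0n ?cuts_gt0// mulrC -ltr_pdivrMr//.
  apply: lt_le_trans (truncnS_gt _) _; rewrite ler_nat.
  by apply: leq_trans (ltnW (cuts_ge r_ge2 (n + k))); exact: leq_addl.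
have [//|[j' [jh' jx' jE]]] := not_top_or_right_end k jh jx.
by move: jx'; rewrite /ro_level /= in_itv /= => /andP[? _]; rewrite /e in we; lra.
Qed.

Lemma below_top_common x y : X x -> X y -> exists n i j,
  [/\ (i.+1 < h n)%N, (j.+1 < h n)%N, level n i x & level n j y].
Proof.
move=> /below_top[n [i [ih ix]]] /below_top[m [j [jh jy]]].
have [p [_ [pN px _]]] := level_refine (leq_maxl n m) (ltnW ih) ix.
have [q [_ [qN qy _]]] := level_refine (leq_maxr n m) (ltnW jh) jy.
by exists (maxn n m), (p + i)%N, (q + j)%N; split => //; lia.
Qed.

Lemma T_inj x y : X x -> X y -> T x = T y -> x = y.
Proof.
move=> Xx Xy Txy; have [n [i [j [ih jh ix jy]]]] := below_top_common Xx Xy.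
have ij : i = j.
  apply/succn_inj/(@level_uniq n _ _ (T x)) => //; first exact: T_level_up.
  by rewrite Txy; exact: T_level_up.
by move: Txy; rewrite (T_level ih ix) (T_level jh jy) ij => /addIr.
Qed.

Lemma T_space x : X x -> X (T x).
Proof.
move=> /below_top[n [j [jh jx]]]; apply/spaceP; exists n, j.+1; split => //.
exact: T_level_up.
Qed.

Lemma measurable_space : measurable X.
Proof. by apply: bigcupT_measurable => n; exact: measurable_itv. Qed.

Lemma T_preserving : measure_preserving_injection X T.
Proof.
(* Pairs (column, level) are enumerated by their codes. Invalid codes default to [(0, 0)], whose
   piece is empty because [h 0 = 1]. *)
pose nj k : nat * nat := odflt (0%N, 0%N) (unpickle k).
pose P k := if ((nj k).2.+1 < h (nj k).1)%N then level (nj k).1 (nj k).2 else set0.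
apply: (@piecewise_translation_preserving _ _ _ P
  (fun k => L (nj k).1 (nj k).2.+1 - L (nj k).1 (nj k).2)).
- apply/seteqP; split => [x /below_top[n [j [jh jx]]]|x [k _]].
    by exists (pickle (n, j)) => //; rewrite /P /nj pickleK /= jh.
  rewrite /P; case: ifP => // jh jx; apply/spaceP.
  by exists (nj k).1, (nj k).2; split => //; exact: ltnW.
- by move=> k; rewrite /P; case: ifP => // _; exact: measurable_level.
- by move=> k x; rewrite /P; case: ifP => // jh jx; exact: T_level.
- exact: T_inj.
- exact: T_space.
Qed.

Lemma iter_T_preserving k : measure_preserving_injection X (iter k T).
Proof. exact: iter_preserving measurable_space T_preserving. Qed.

Lemma level_space n j : (j < h n)%N -> level n j `<=` X.
Proof. by move=> jh x jx; apply/spaceP; exists n, j. Qed.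

(** [T^k] maps level [j] onto level [j + k] and is injective on [X], so a point arriving there can
    only come from level [j]. *)
Lemma iter_level_down n j k x : (j + k < h n)%N -> X x ->
  level n (j + k) (iter k T x) -> level n j x.
Proof.
move=> jk Xx; rewrite -{1}iter_level_image// => -[y jy yx].
have [Tinj _ _ _] := iter_T_preserving k.
have -> : x = y; last by [].
by apply: Tinj => //; apply: level_space jy; lia.
Qed.

Lemma muR_level n j : muR (level n j) = w n.
Proof.
have w0n := width_gt0 n; rewrite /ro_level muR_itvco; last by lra.
by rewrite addrC addKr.
Qed.

Lemma base_level n : level n 0 = `[0, w n[%classic.
Proof. by rewrite levelE level_index0// /cell mul0r add0r. Qed.

Lemma I0E : I0 w0 r s = `[0, w0[%classic.
Proof. by rewrite /I0 base_level /ro_width big_ord0 divr1. Qed.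

Lemma I0_prefix n : I0 w0 r s = `[0, (\prod_(k < n) r k)%:R * w n[%classic.
Proof.
rewrite I0E /ro_width mulrC divfK//.
by rewrite pnatr_eq0 -lt0n cuts_gt0.
Qed.

Lemma I0_level n x : I0 w0 r s x -> exists j : 'I_(h n),
  (idx n j < \prod_(k < n) r k)%N /\ level n j x.
Proof.
rewrite (I0_prefix n) => /(cell_prefixP _ _ (width_gt0 n))[q qQ qx].
have [j jh jq] := level_index_surj r_ge2 (leq_trans qQ (cuts_le_height s r_ge2 n)).
by exists (Ordinal jh); rewrite levelE /= jq.
Qed.

Lemma level_I0 n j : (idx n j < \prod_(k < n) r k)%N -> level n j `<=` I0 w0 r s.
Proof.
move=> jQ x; rewrite levelE (I0_prefix n) => jx.
by apply/(cell_prefixP _ _ (width_gt0 n)); exists (idx n j).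
Qed.

Lemma I0_space : I0 w0 r s `<=` X.
Proof. exact: (@level_space 0). Qed.

Lemma space_swept x : X x -> exists k, (iter k T @` I0 w0 r s) x.
Proof.
move=> /spaceP[n [j [jh jx]]]; exists j.
have : (iter j T @` level n 0) x by rewrite iter_level_image.
by move=> [y y0 <-]; exists y => //; apply: level_I0 y0; rewrite level_index0 ?cuts_gt0.
Qed.

End RankOneMap.

(** * Visits to the base *)

(** Pairs [i <= j], diagonal included, carry at least half of the square of the total. *)
Lemma triangle_sum (d : nat -> nat) n :
  ((\sum_(j < n) d j) ^ 2 <= 2 * \sum_(j < n) d j * \sum_(i < j.+1) d i)%N.
Proof.
elim: n => [|n IH]; first by rewrite !big_ord0.
rewrite !big_ord_recr /=.
move: IH; move: (\sum_(j < n) _ * _)%N (\sum_(j < n) d j)%N => t u; nia.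
Qed.

(** After the shift only the first term of [g] and the last term of [f] survive in the
    difference. *)
Lemma shifted_sum_dist (R : realDomainType) (f g : nat -> R) c n :
  (forall k, 0 <= f k <= c) -> (forall k, 0 <= g k <= c) ->
  (forall k, g k.+1 = f k) ->
  `|\sum_(k < n) g k - \sum_(k < n) f k| <= c.
Proof.
move=> fc gc gf; have c0 : 0 <= c by have /andP[/le_trans H /H] := fc 0%N.
case: n => [|n]; first by rewrite !big_ord0 subrr normr0.
rewrite big_ord_recl big_ord_recr /=.
under eq_bigr do rewrite /bump /= add1n gf.
rewrite ler_norml; have /andP[? ?] := fc n; have /andP[? ?] := gc 0%N.
by apply/andP; split; lra.
Qed.

Section Visits.
Variables (R : realType) (w0 : R) (r : nat -> nat) (s : nat -> nat -> nat).
Hypothesis w0_gt0 : 0 < w0.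
Hypothesis r_ge2 : forall n, (2 <= r n)%N.
Local Notation mu := (@lebesgue_measure R).
Local Notation h := (ro_height r s).
Local Notation w := (ro_width w0 r).
Local Notation level := (ro_level w0 r s).
Local Notation X := (ro_space w0 r s).
Local Notation T := (rank_one_map w0 r s).
Local Notation F := (I0 w0 r s).
Local Notation idx := (level_index r s).
Local Notation Q m := (\prod_(k < m) r k)%N.

(** An orbit leaving the base of [C_m] climbs the column, so [t' - t] steps later it is in level
    [t' - t], which is the base only if the times agree. *)
Lemma base_return m t t' x : (t <= t')%N -> (t' - t < h m)%N -> X x ->
  level m 0 (iter t T x) -> level m 0 (iter t' T x) -> t = t'.
Proof.
move=> tt th Xx x0; rewrite -(subnK tt) iterD => x1.
have x2 := @iter_level_up R w0 r s w0_gt0 r_ge2 m 0 (t' - t) _ th x0.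
have := level_uniq w0_gt0 r_ge2 th (height_gt0 s r_ge2 m) x2 x1.
by lia.
Qed.

(* A visit at time k lies in some level j of C_m inside F. If k < j the orbit
   started inside C_m, at level j - k; otherwise it entered C_m through its base
   at time k - j, and this can happen only once in time h m. Either way j
   determines k. *)
Lemma forward_visits m n x : (n <= h m)%N -> X x ->
  (\sum_(k < n) (iter k T x \in F) <= 2 * Q m)%N.
Proof.
move=> nh Xx.
pose S := [set k : 'I_n | iter k T x \in F]%SET.
pose D := [set j : 'I_(h m) | (idx m j < Q m)%N]%SET.
have -> : (\sum_(k < n) (iter k T x \in F))%N = #|S|.
  by rewrite -sum1_card [in RHS]big_mkcond; apply: eq_bigr => k _; rewrite inE; case: ifP.
have cD : #|D| = Q m by apply: card_level_index_lt => //; exact: cuts_le_height.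
pose j0 := Ordinal (height_gt0 s r_ge2 m).
pose g (k : 'I_n) := odflt j0 [pick j : 'I_(h m) |
  (idx m j < Q m)%N && (iter k T x \in level m j)].
have gP k : k \in S -> g k \in D /\ level m (g k) (iter k T x).
  rewrite inE => /set_mem /(I0_level w0_gt0 r_ge2 m)[j [jQ jx]].
  rewrite /g; case: pickP => [i /andP[iQ /set_mem ix]|/(_ j)].
    by rewrite inE.
  by rewrite jQ mem_set.
pose S1 := [set k in S | (k < g k)%N]%SET.
pose S2 := [set k in S | (g k <= k)%N]%SET.
have XT k : X (iter k T x) by have [_ + _ _] := iter_T_preserving s w0_gt0 r_ge2 k; apply.
have Sle (A : {set 'I_n}) : (A \subset S) -> {in A &, injective g} -> (#|A| <= Q m)%N.
  move=> AS gi; rewrite -(card_in_imset gi) -cD; apply/subset_leq_card/fintype.subsetP.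
  by move=> _ /imsetP[k kA ->]; have [] := gP k (fintype.subsetP AS _ kA).
have S1i : {in S1 &, injective g}.
  move=> k k'; rewrite !inE => /andP[/set_mem kF kg] /andP[/set_mem kF' kg'] gE.
  have [_ l1] := gP k ltac:(by rewrite inE mem_set).
  have [_ l2] := gP k' ltac:(by rewrite inE mem_set).
  have := ltn_ord (g k); have := ltn_ord (g k') => gh' gh.
  have d1 : level m (g k - k) x.
    by apply: (@iter_level_down R w0 r s w0_gt0 r_ge2 m _ k) => //; rewrite subnK// ltnW.
  have d2 : level m (g k' - k') x.
    by apply: (@iter_level_down R w0 r s w0_gt0 r_ge2 m _ k') => //; rewrite subnK// ltnW.
  have := @level_uniq R w0 r s w0_gt0 r_ge2 m _ _ x _ _ d1 d2.
  by move=> /(_ ltac:(lia) ltac:(lia)) E; apply: val_inj => /=; rewrite -gE in kg' E; lia.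
have S2i : {in S2 &, injective g}.
  move=> k k'; rewrite !inE => /andP[/set_mem kF kg] /andP[/set_mem kF' kg'] gE.
  have [_ l1] := gP k ltac:(by rewrite inE mem_set).
  have [_ l2] := gP k' ltac:(by rewrite inE mem_set).
  have := ltn_ord k; have := ltn_ord k' => kn' kn.
  have d1 : level m 0 (iter (k - g k) T x).
    apply: (@iter_level_down R w0 r s w0_gt0 r_ge2 m 0 (g k)); [exact: ltn_ord|exact: XT|].
    by rewrite -iterD subnKC.
  have d2 : level m 0 (iter (k' - g k') T x).
    apply: (@iter_level_down R w0 r s w0_gt0 r_ge2 m 0 (g k')); [exact: ltn_ord|exact: XT|].
    by rewrite -iterD subnKC.
  apply: val_inj => /=; rewrite -gE in d2 kg'.
  case: (leqP (k - g k)%N (k' - g k)%N) => [le|/ltnW le].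
    by have := base_return le _ Xx d1 d2; move=> /(_ ltac:(lia)); lia.
  by have := base_return le _ Xx d2 d1; move=> /(_ ltac:(lia)); lia.
have -> : S = (S1 :|: S2)%SET.
  by apply/setP => k; rewrite !inE -andb_orr ltnNge orNb andbT.
apply: leq_trans (leq_card_setU _ _) _; rewrite mul2n -addnn leq_add// Sle//.
  by apply/fintype.subsetP => k; rewrite inE => /andP[].
by apply/fintype.subsetP => k; rewrite inE => /andP[].
Qed.

(** Time reversal: if [x = T^n y] with [y] in [F], then by injectivity each [k] with [x] in [T^k F]
    is a visit of [y] to [F] at time [n - k]. If the last index does not contribute, it is dropped
    by induction. *)
Lemma backward_visits m n x : (n <= h m)%N ->
  (\sum_(k < n) (x \in iter k T @` F) <= 2 * Q m)%N.
Proof.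
elim: n => [|n IH] nh; first by rewrite big_ord0.
have [xF|xF] := boolP (x \in iter n T @` F); last first.
  by rewrite big_ord_recr /= (negbTE xF) addn0 IH// ltnW.
have [y Fy yx] := set_mem xF.
apply: leq_trans (@forward_visits m n.+1 y nh (I0_space w0_gt0 r_ge2 Fy)).
rewrite [leqRHS](reindex_inj rev_ord_inj) /=; apply: leq_sum => k _.
rewrite subSS; case: (boolP (x \in _)) => // /set_mem[z Fz zx].
rewrite mem_set//=; have [Tinj _ _ _] := iter_T_preserving s w0_gt0 r_ge2 k.
have [_ TX _ _] := iter_T_preserving s w0_gt0 r_ge2 (n - k).
have -> : iter (n - k) T y = z; last by [].
have FX := I0_space w0_gt0 r_ge2.
apply: Tinj; [by apply/TX/FX|exact: FX|].
by rewrite -iterD subnKC ?yx ?zx// -ltnS.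
Qed.

(** * Lower bound for return sums and growth of [a_seq] *)

Definition return_sum (A B : set R) n := \sum_(k < n) muR (A `&` iter k T @` B).

Lemma measurable_I0 : measurable F.
Proof. exact: measurable_level. Qed.

Lemma muR_I0 : muR F = w0.
Proof. by rewrite muR_level// /ro_width big_ord0 divr1. Qed.

Lemma mu_I0 : mu F = w0%:E.
Proof. by rewrite I0E// mu_itvco ?subr0// ltW. Qed.

Lemma mu_sub_I0_lty A : measurable A -> A `<=` F -> (mu A < +oo)%E.
Proof.
move=> mA AF; apply: (@le_lt_trans _ _ (mu F)); last by rewrite mu_I0 ltry.
by apply: le_measure; rewrite ?inE //; exact: measurable_I0.
Qed.

Lemma measurable_iter_image k A : measurable A -> A `<=` F ->
  measurable (iter k T @` A) /\ mu (iter k T @` A) = mu A.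
Proof.
move=> mA AF; have [_ _ + _] := iter_T_preserving s w0_gt0 r_ge2 k; apply => //.
exact: subset_trans (I0_space w0_gt0 r_ge2).
Qed.

Lemma return_sum_ge0 A B n : 0 <= return_sum A B n.
Proof. by apply: sumr_ge0 => k _; exact: muR_ge0. Qed.

(** If levels [j] and [j - k] of [C_m] both lie in [F], then level [j] lies in [F] and in [T^k F].
    Summed over [k < h m], this counts pairs [i <= j] of levels in [F], at least half of [(Q m)^2],
    each of measure [w m], and [Q m * w m = w0]. *)
Lemma return_sum_lower m n : (h m <= n)%N ->
  (Q m)%:R * w0 <= 2 * return_sum F F n.
Proof.
move=> hn; pose d j : nat := (idx m j < Q m)%N.
pose c k : nat := (\sum_(j < h m) d j * (if k <= j then d (j - k) else 0))%N.
have w0m := width_gt0 w0_gt0 r_ge2 m.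
have ck k : (c k)%:R * w m <= muR (F `&` iter k T @` F).
  have [mT _] := measurable_iter_image k measurable_I0 (@subset_refl _ F).
  have mI : measurable (F `&` iter k T @` F) by exact: measurableI measurable_I0 mT.
  have IF : F `&` iter k T @` F `<=` F by exact: subIsetl.
  (* The levels counted by [c k], with empty sets elsewhere. They are disjoint, so the multiplicity
     bound applies with constant 1. *)
  pose G (j : nat) := if (j < h m)%N && (d j * (if (k <= j)%N then d (j - k)%N else 0) == 1)%N
    then level m j else set0.
  have GI j : G j `<=` F `&` iter k T @` F.
    rewrite /G; case: ifP => // /andP[jh]; rewrite /d.
    case: (ltnP (idx m j) (Q m)) => // jQ; case: (leqP k j) => // kj.
    case: (ltnP (idx m (j - k)) (Q m)) => // jkQ _ x jx; split.
      exact: level_I0 jQ _ jx.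
    move: jx; rewrite -{1}(subnK kj) -iter_level_image ?subnK// => -[y jy <-].
    by exists y => //; exact: level_I0 jkQ _ jy.
  have mG j : measurable (F `&` iter k T @` F `&` G j).
    by rewrite setIidr//; rewrite /G; case: ifP => // _; exact: measurable_level.
  have multiplicity x : (F `&` iter k T @` F) x ->
      (\sum_(j < h m) (x \in G j) <= 1)%N.
    move=> _.
    have [/existsP[i iG]|/existsPn noG] := boolP [exists i : 'I_(h m), x \in G i].
      rewrite (bigD1 i)//= big1 ?addn0 ?leq_b1// => j ji.
      apply/eqP; rewrite eqb0; apply/negP => /set_mem jG.
      move/set_mem : iG; move: jG; rewrite /G !ltn_ord /=.
      case: ifP => // _ jx; case: ifP => // _ ix.
      case/eqP: ji; apply: val_inj.
      exact: level_uniq w0_gt0 r_ge2 _ _ _ _ (ltn_ord j) (ltn_ord i) jx ix.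
    by rewrite big1// => i _; rewrite (negbTE (noG i)).
  have := sum_muR_multiplicity_le mI (mu_sub_I0_lty mI IF) mG multiplicity.
  rewrite mul1r; apply: le_trans.
  rewrite /c natr_sum mulr_suml; apply: ler_sum => j _.
  rewrite setIidr// /G ltn_ord /= /d; case: (idx m j < Q m)%N => /=; last first.
    by rewrite mul0n mul0r muR_ge0.
  case: (leqP k j) => kj; last by rewrite muln0 mul0r muR_ge0.
  by case: (idx m (j - k) < Q m)%N; rewrite /= ?mul1r ?muR_level// mul0r muR_ge0.
have dQ : (\sum_(j < h m) d j)%N = Q m.
  have QH := cuts_le_height s r_ge2 m.
  rewrite -[RHS](card_level_index_lt r_ge2 QH) -sum1_card [in RHS]big_mkcond.
  by apply: eq_bigr => k _; rewrite inE /d; case: ifP.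
(* After exchanging the sums, [i = j - k] reindexes the lags [k <= j] for each fixed [j]. *)
have cT : (\sum_(k < h m) c k)%N = (\sum_(j < h m) d j * \sum_(i < j.+1) d i)%N.
  rewrite /c exchange_big /=; apply: eq_bigr => j _; rewrite -big_distrr /=.
  congr (_ * _)%N; rewrite -big_mkcond /= [RHS](reindex_inj rev_ord_inj) /=.
  under [RHS]eq_bigr do rewrite subSS.
  by rewrite (big_ord_widen _ (fun i => d (j - i)%N) (ltn_ord j)).
have := triangle_sum d (h m); rewrite dQ -cT => tri.
have Qw : (Q m)%:R * w m = w0.
  by rewrite /ro_width mulrC divfK// pnatr_eq0 -lt0n cuts_gt0.
rewrite -[X in _ * X <= _]Qw mulrA -natrM.
apply: le_trans (_ : (2 * \sum_(k < h m) c k)%N%:R * w m <= _).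
  by rewrite ler_pM2r// ler_nat.
rewrite natrM -mulrA ler_pM2l// natr_sum mulr_suml.
apply: le_trans (_ : \sum_(k < h m) muR (F `&` iter k T @` F) <= _).
  by apply: ler_sum => k _; exact: ck.
rewrite /return_sum (big_ord_widen _ (fun k => muR (F `&` iter k T @` F)) hn).
by rewrite big_mkcond /=; apply: ler_sum => k _; case: ifP => // _; exact: muR_ge0.
Qed.

Lemma a_seqE n : a_seq T F n = return_sum F F n / w0 ^+ 2.
Proof. by rewrite /a_seq /u_seq muR_I0 mulr_suml. Qed.

Lemma a_seq_ge0 n : 0 <= a_seq T F n.
Proof. by rewrite a_seqE divr_ge0 ?return_sum_ge0// sqr_ge0. Qed.

Lemma a_seq_lower m n : (h m <= n)%N -> (Q m)%:R <= 2 * w0 * a_seq T F n.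
Proof.
move=> /return_sum_lower; rewrite a_seqE => le.
rewrite -(ler_pM2r w0_gt0) (le_trans le)//.
have w0n : w0 != 0 by rewrite gt_eqF.
by have -> : 2 * w0 * (return_sum F F n / w0 ^+ 2) * w0 = 2 * return_sum F F n by field.
Qed.

Lemma a_seq_gt0 n : (0 < n)%N -> 0 < a_seq T F n.
Proof.
move=> n0; have := @a_seq_lower 0 n n0; rewrite big_ord0 => le.
have : 0 < 2 * w0 * a_seq T F n by exact: lt_le_trans le.
by rewrite pmulr_rgt0// mulr_gt0.
Qed.

Lemma cvg_over_a_seq (c : R) : 0 <= c -> forall f : nat -> R,
  (forall n, `|f n| <= c) -> f n / a_seq T F n @[n --> \oo] --> (0 : R).
Proof.
move=> c0 f fc; apply/cvgrPdist_le => e e0.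
(* From time [h m] on, [2 * w0 * a_n >= Q m > m > 2 * w0 * c / e], so [c <= e * a_n]. *)
pose m := (Num.truncn (2 * w0 * c / e)).+1.
near=> n; have hn : (h m <= n)%N by near: n; exact: nbhs_infty_ge.
have an : 0 < a_seq T F n by apply/a_seq_gt0/(leq_trans (height_gt0 s r_ge2 m)).
rewrite sub0r normrN normrM normfV (gtr0_norm an) ler_pdivrMr//.
apply: le_trans (fc n) _.
have w2 : 0 < 2 * w0 by rewrite mulr_gt0.
rewrite -(ler_pM2l w2) mulrCA -ler_pdivrMl//.
apply: le_trans (a_seq_lower hn); rewrite mulrC.
apply: ltW; apply: lt_le_trans (truncnS_gt _) _; rewrite ler_nat -/m.
exact: ltnW (cuts_ge r_ge2 m).
Unshelve. all: by end_near. Qed.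

Lemma height_bracket n : (0 < n)%N -> exists m, (h m <= n < h m.+1)%N.
Proof.
move=> n0; have [N nN] := height_unbounded s r_ge2 n.
elim: N nN => [|N IH] nN; first by move: nN => /=; lia.
by case: (ltnP n (h N)) => [/IH//|Nn]; exists N; rewrite Nn nN.
Qed.

(** Here bounded cutting enters. For [h m <= n < h (m + 1)] both counts are at most
    [K = 2 * Q (m + 1) <= 2 * M * Q m], while [Q m <= 2 * w0 * a_n]. *)
Lemma visits_le_a_seq M : (forall n, (r n <= M)%N) -> forall n, exists K : nat,
  [/\ K%:R <= 4 * M%:R * w0 * a_seq T F n,
      (forall x, X x -> (\sum_(k < n) (iter k T x \in F) <= K)%N) &
      (forall x, (\sum_(k < n) (x \in iter k T @` F) <= K)%N)].
Proof.
move=> rM [|n].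
  exists 0%N; split=> [|x _|x]; rewrite ?big_ord0//.
  by rewrite mulr_ge0 ?a_seq_ge0// !mulr_ge0// ltW.
have [m /andP[mn nm]] := height_bracket (ltn0Sn n).
exists (2 * Q m.+1)%N; split.
- rewrite big_ord_recr /= !natrM; have le := a_seq_lower mn.
  have rMR : (r m)%:R <= M%:R :> R by rewrite ler_nat.
  have -> : 4 * M%:R * w0 * a_seq T F n.+1 = 2 * ((2 * w0 * a_seq T F n.+1) * M%:R) by ring.
  by rewrite ler_pM2l// ler_pM.
- by move=> x; apply: forward_visits; exact: ltnW.
- by move=> x; apply: backward_visits; exact: ltnW.
Qed.

Lemma muR_iter_image k A : measurable A -> A `<=` F -> muR (iter k T @` A) = muR A.
Proof. by move=> mA AF; rewrite /muR (measurable_iter_image k mA AF).2. Qed.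

Lemma measurable_meet_image k A B : measurable A -> measurable B -> B `<=` F ->
  measurable (A `&` iter k T @` B).
Proof.
move=> mA mB BF; apply: measurableI => //.
exact: (measurable_iter_image k mB BF).1.
Qed.

End Visits.

(** * Return sums *)

Section ReturnSums.
Variables (R : realType) (w0 : R) (r : nat -> nat) (s : nat -> nat -> nat).
Hypothesis w0_gt0 : 0 < w0.
Hypothesis r_ge2 : forall n, (2 <= r n)%N.
Local Notation mu := (@lebesgue_measure R).
Local Notation h := (ro_height r s).
Local Notation w := (ro_width w0 r).
Local Notation X := (ro_space w0 r s).
Local Notation T := (rank_one_map w0 r s).
Local Notation F := (I0 w0 r s).
Local Notation S := (return_sum w0 r s).
Local Notation Q m := (\prod_(k < m) r k)%N.
Implicit Types A B : set R.

Let imT k A : measurable A -> A `<=` X ->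
  [/\ measurable (iter k T @` A), mu (iter k T @` A) = mu A & iter k T @` A `<=` X].
Proof.
move=> mA AX; have [_ TX Tmu _] := iter_T_preserving s w0_gt0 r_ge2 k.
have [mT mTE] := Tmu _ mA AX; split => // _ [x Ax <-]; exact/TX/AX.
Qed.

Let meet_bounds k A B : measurable A -> (mu A < +oo)%E -> measurable B ->
  B `<=` X -> 0 <= muR (A `&` iter k T @` B) <= muR A.
Proof.
move=> mA fA mB BX; have [mT _ _] := imT k mB BX.
rewrite muR_ge0 le_muR//; exact: measurableI mA mT.
Qed.

(** By injectivity, [T A] meets [T^(k+1) B] exactly in the image of [A]&[T^k B]. The two sums are
    shifts of each other, with terms bounded by the measure of [A]. *)
Lemma return_sum_imagel A B n : measurable A -> A `<=` X -> (mu A < +oo)%E ->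
  measurable B -> B `<=` X -> `|S (T @` A) B n - S A B n| <= muR A.
Proof.
move=> mA AX fA mB BX; have [mTA mTAE TAX] := imT 1 mA AX.
have mRT : muR (T @` A) = muR A by rewrite /muR -mTAE.
apply: (@shifted_sum_dist R (fun k => muR (A `&` iter k T @` B))
  (fun k => muR (T @` A `&` iter k T @` B))) => k; first exact: meet_bounds.
  by rewrite -mRT; apply: meet_bounds => //; rewrite -mTAE in fA.
have [mTB _ TBX] := imT k mB BX.
have [Tinj _ _ _] := T_preserving s w0_gt0 r_ge2.
have -> : T @` A `&` iter k.+1 T @` B = T @` (A `&` iter k T @` B).
  apply/seteqP; split => [_ [[x Ax <-] [y By yx]]|_ [x [Ax [y By yx]] <-]].
    exists x => //; split => //; exists y => //; apply: Tinj => //; last exact: AX.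
    by apply: TBX; exists y.
  by split; [exists x|exists y => //=; rewrite yx].
have mI : measurable (A `&` iter k T @` B) by exact: measurableI mA mTB.
have IX : A `&` iter k T @` B `<=` X by move=> x [/AX].
by have [_ + _] := imT 1 mI IX; rewrite /muR => ->.
Qed.

Lemma return_sum_imager A B n : measurable A -> (mu A < +oo)%E ->
  measurable B -> B `<=` X -> `|S A (T @` B) n - S A B n| <= muR A.
Proof.
move=> mA fA mB BX; have [mTB _ TBX] := imT 1 mB BX; rewrite distrC.
apply: (@shifted_sum_dist R (fun k => muR (A `&` iter k T @` (T @` B)))
  (fun k => muR (A `&` iter k T @` B))) => k; [exact: meet_bounds|exact: meet_bounds|].
rewrite image_comp; congr (muR (_ `&` _)).
by apply: eq_imagel => x _ /=; rewrite -iterSr.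
Qed.

Let image_iterS j A : iter j.+1 T @` A = T @` (iter j T @` A).
Proof. by rewrite image_comp. Qed.

Lemma return_sum_iterl j A B n : measurable A -> A `<=` X -> (mu A < +oo)%E ->
  measurable B -> B `<=` X ->
  `|S (iter j T @` A) B n - S A B n| <= j%:R * muR A.
Proof.
move=> mA AX fA mB BX; elim: j => [|j IH].
  by rewrite [_ @` A]image_id subrr normr0 mul0r.
have [mTA mTAE TAX] := imT j mA AX.
have := @return_sum_imagel (iter j T @` A) B n mTA TAX.
rewrite mTAE => /(_ fA mB BX); rewrite -image_iterS [leRHS]/muR mTAE -/(muR A) => le.
rewrite -natr1 mulrDl mul1r [leRHS]addrC.
by apply: le_trans (ler_distD (S (iter j T @` A) B n) _ _) _; exact: lerD.
Qed.

Lemma return_sum_iterr j A B n : measurable A -> (mu A < +oo)%E ->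
  measurable B -> B `<=` X ->
  `|S A (iter j T @` B) n - S A B n| <= j%:R * muR A.
Proof.
move=> mA fA mB BX; elim: j => [|j IH].
  by rewrite [_ @` B]image_id subrr normr0 mul0r.
have [mTB mTBE TBX] := imT j mB BX.
have := @return_sum_imager A (iter j T @` B) n mA fA mTB TBX.
rewrite -image_iterS => le.
rewrite -natr1 mulrDl mul1r [leRHS]addrC.
by apply: le_trans (ler_distD (S A (iter j T @` B) n) _ _) _; exact: lerD.
Qed.

(** Cell [q] is some level [j] of [C_m], and cell 0 is the bottom level, from which [j] steps lead
    to it. *)
Lemma cell_iter_image m q : (q < Q m)%N -> exists2 j, (j < h m)%N &
  cell (w m) q = iter j T @` cell (w m) 0.
Proof.
move=> qQ.
have [j jh jq] := level_index_surj r_ge2 (leq_trans qQ (cuts_le_height s r_ge2 m)).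
exists j => //; have := @iter_level_image R w0 r s w0_gt0 r_ge2 m 0 j jh.
by rewrite !(levelE _ _ r_ge2) (level_index0 s r_ge2) add0n jq => ->.
Qed.

Lemma cell_I0 m q : (q < Q m)%N -> cell (w m) q `<=` F.
Proof.
move=> qQ x qx; rewrite (I0_prefix _ _ r_ge2 m).
by apply/(cell_prefixP _ _ (width_gt0 w0_gt0 r_ge2 m)); exists q.
Qed.

Let measurable_cell (v : R) q : measurable (cell v q).
Proof. exact: measurable_itv. Qed.

Let FX : F `<=` X. Proof. exact: I0_space. Qed.

Let fin A : measurable A -> A `<=` F -> (mu A < +oo)%E.
Proof. exact: mu_sub_I0_lty. Qed.

(** The numerators differ by at most [j] times the measure of cell 0, a bound independent of [n],
    whereas [a_seq] tends to infinity. *)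
Lemma return_sum_cell_left m q B : (q < Q m)%N -> measurable B -> B `<=` F ->
  (S (cell (w m) q) B n / a_seq T F n - S (cell (w m) 0) B n / a_seq T F n)
    @[n --> \oo] --> (0 : R).
Proof.
move=> qQ mB BF; have [j jh ->] := cell_iter_image qQ.
have cF : cell (w m) 0 `<=` F by apply: cell_I0; exact: cuts_gt0.
have c0 : 0 <= j%:R * muR (cell (w m) 0) by rewrite mulr_ge0// muR_ge0.
under eq_fun do rewrite -mulrBl.
apply: (cvg_over_a_seq s w0_gt0 r_ge2 c0) => n.
apply: return_sum_iterl.
- exact: measurable_cell.
- exact: subset_trans FX.
- by apply: fin cF; exact: measurable_cell.
- exact: mB.
- exact: subset_trans FX.
Qed.

Lemma return_sum_cell_right m q A : (q < Q m)%N -> measurable A -> A `<=` F ->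
  (S A (cell (w m) q) n / a_seq T F n - S A (cell (w m) 0) n / a_seq T F n)
    @[n --> \oo] --> (0 : R).
Proof.
move=> qQ mA AF; have [j jh ->] := cell_iter_image qQ.
have cF : cell (w m) 0 `<=` F by apply: cell_I0; exact: cuts_gt0.
have c0 : 0 <= j%:R * muR A by rewrite mulr_ge0// muR_ge0.
under eq_fun do rewrite -mulrBl.
apply: (cvg_over_a_seq s w0_gt0 r_ge2 c0) => n.
apply: return_sum_iterr.
- exact: mA.
- exact: fin.
- exact: measurable_cell.
- exact: subset_trans FX.
Qed.

Lemma return_sumUl n A A' B : measurable A -> measurable A' ->
  A `<=` F -> A' `<=` F -> measurable B -> B `<=` F -> A `&` A' = set0 ->
  S (A `|` A') B n = S A B n + S A' B n.
Proof.
move=> mA mA' AF AF' mB BF AA'; rewrite /return_sum -big_split /=.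
have mI := measurable_meet_image w0_gt0 r_ge2.
apply: eq_bigr => k _; rewrite setIUl muR_disjointU//.
- exact: mI.
- exact: mI.
- by apply: fin; [exact: mI|move=> x [/AF]].
- by apply: fin; [exact: mI|move=> x [/AF']].
- by rewrite setIACA AA' set0I.
Qed.

Lemma return_sumUr n A B B' : measurable A -> A `<=` F -> measurable B ->
  measurable B' -> B `<=` F -> B' `<=` F -> B `&` B' = set0 ->
  S A (B `|` B') n = S A B n + S A B' n.
Proof.
move=> mA AF mB mB' BF BF' BB'; rewrite /return_sum -big_split /=.
have mI := measurable_meet_image w0_gt0 r_ge2.
apply: eq_bigr => k _; rewrite image_setU setIUr muR_disjointU//.
- exact: mI.
- exact: mI.
- by apply: fin; [exact: mI|move=> x [/AF]].
- by apply: fin; [exact: mI|move=> x [/AF]].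
- have [Tinj _ _ _] := iter_T_preserving s w0_gt0 r_ge2 k.
  apply/seteqP; split => // x [[_ [y By yx]] [_ [z Bz zx]]].
  have yz : y = z by apply: Tinj; rewrite ?yx//; apply: FX; [exact: BF|exact: BF'].
  have : (B `&` B') y by split; [exact: By|rewrite yz].
  by rewrite BB'.
Qed.

(** * Domination and limits under bounded cutting *)

Variable M : nat.
Hypothesis r_le : forall n, (r n <= M)%N.
Let C : R := 4 * M%:R * w0.

Let div_a_seq_le n (K : nat) x y : (0 <= y) ->
  K%:R <= C * a_seq T F n -> x <= K%:R * y -> x / a_seq T F n <= C * y.
Proof.
(* A zero divisor, as at [n = 0], makes the quotient 0 by convention. *)
move=> y0 KC xK; have [->|a0] := eqVneq (a_seq T F n) 0.
  by rewrite invr0 mulr0 !mulr_ge0// ltW.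
have a_gt0 : 0 < a_seq T F n by rewrite lt_neqAle eq_sym a0 a_seq_ge0.
by rewrite ler_pdivrMr// (le_trans xK)// mulrAC ler_wpM2r.
Qed.

(** After enlarging [B] to [F], each point of [A] is counted once for each [k] with [x] in [T^k F],
    which the backward count bounds. *)
Lemma return_sum_le_left n A B : measurable A -> A `<=` F -> measurable B ->
  B `<=` F -> S A B n / a_seq T F n <= C * muR A.
Proof.
move=> mA AF mB BF; have [K [KC _ bK]] := visits_le_a_seq s w0_gt0 r_ge2 r_le n.
apply: (div_a_seq_le (muR_ge0 A) KC).
have mI := measurable_meet_image w0_gt0 r_ge2.
have mF := measurable_I0 w0 r s.
apply: le_trans (_ : S A F n <= _).
  apply: ler_sum => k _; apply: le_muR; [exact: mI|exact: mI| |].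
    by apply: fin; [exact: mI|move=> x [/AF]].
  by apply: setIS; exact: image_subset.
apply: (@sum_muR_multiplicity_le R n K A (fun k => iter k T @` F)) => //.
  exact: fin.
by move=> k; exact: mI.
Qed.

Lemma return_sum_le_right n A B : measurable A -> A `<=` F -> measurable B ->
  B `<=` F -> S A B n / a_seq T F n <= C * muR B.
Proof.
move=> mA AF mB BF; have [K [KC fK _]] := visits_le_a_seq s w0_gt0 r_ge2 r_le n.
apply: (div_a_seq_le (muR_ge0 B) KC).
have mF := measurable_I0 w0 r s.
(* Pulling back by [T^k] bounds each term by the measure of the points of [B] that are in [F] at
   time [k], so forward visits are counted instead. *)
pose G k := [set x | X x /\ F (iter k T x)].
have mG k : measurable (B `&` G k).
  have [_ _ _ mpre] := iter_T_preserving s w0_gt0 r_ge2 k.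
  exact: measurableI mB (mpre _ mF).
have BG k : B `&` G k `<=` F by move=> x [/BF].
have mI := measurable_meet_image w0_gt0 r_ge2.
apply: le_trans (_ : \sum_(k < n) muR (B `&` G k) <= _).
  apply: ler_sum => k _.
  have [mT mTE] := measurable_iter_image w0_gt0 r_ge2 k (mG k) (BG k).
  rewrite -(muR_iter_image w0_gt0 r_ge2 k (mG k) (BG k)); apply: le_muR => //.
  - exact: mI.
  - by rewrite mTE; exact: fin.
  - move=> x [Ax [y By yx]]; exists y => //; split => //; split; first exact/FX/BF.
    by rewrite yx; exact: AF.
apply: (@sum_muR_multiplicity_le R n K B G) => //; first exact: fin.
move=> x Bx; apply: leq_trans (fK x (FX (BF _ Bx))).
apply: leq_sum => k _; case: (boolP (x \in G k)) => // /set_mem[_ xF].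
by rewrite mem_set.
Qed.

Lemma return_sum_div_ge0 A B n : 0 <= S A B n / a_seq T F n.
Proof. by rewrite divr_ge0 ?return_sum_ge0// a_seq_ge0. Qed.

Let C_ge0 : 0 <= C. Proof. by rewrite !mulr_ge0// ltW. Qed.

Let Q_unbounded N : exists m, (N <= Q m)%N.
Proof. by exists N; apply: ltnW; exact: cuts_ge. Qed.

Lemma return_sum_I0_cvg : S F F n / a_seq T F n @[n --> \oo] --> w0 * w0.
Proof.
apply: cvg_near_cst; exists 1%N => // n n1 /=.
have an := a_seq_gt0 s w0_gt0 r_ge2 n1; rewrite a_seqE// in an *.
have S0 : S F F n != 0.
  by apply: contraTneq an => ->; rewrite mul0r ltxx.
by rewrite invfM invrK mulrA divff// mul1r expr2.
Qed.

(** Averaging in the first argument, with the second fixed at [F]. The limit at [A = F] is exact, as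
    [a_seq] is the return sum of [F] divided by [w0 ^+ 2]. *)
Lemma return_sum_left_cvg A : measurable A -> A `<=` F ->
  S A F n / a_seq T F n @[n --> \oo] --> w0 * muR A.
Proof.
have mF := measurable_I0 w0 r s; have F0 : F = `[0, w0[%classic by exact: I0E.
move=> mA; rewrite {1}F0 => AF.
apply: (@cell_averaging R w0 C w0 (fun m => Q m)
  (fun n A => S A F n / a_seq T F n)) => //; rewrite -?F0.
- by move=> m; exact: cuts_gt0.
- move=> n A1 A2 m1 m2 AF1 AF2 A12.
  by rewrite return_sumUl// mulrDl.
- by move=> n A1; exact: return_sum_div_ge0.
- by move=> n A1 m1 AF1; exact: return_sum_le_left.
- exact: return_sum_I0_cvg.
- by move=> m q qQ; exact: return_sum_cell_left.
Qed.

(** Averaging now in the second argument with [A] fixed; the value at [B = F] that it starts from is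
    the limit already found. *)
Lemma return_sum_cvg A B : measurable A -> measurable B -> A `<=` F ->
  B `<=` F -> S A B n / a_seq T F n @[n --> \oo] --> muR A * muR B.
Proof.
have mF := measurable_I0 w0 r s; have F0 : F = `[0, w0[%classic by exact: I0E.
move=> mA mB AF; rewrite {1}F0 => BF.
apply: (@cell_averaging R w0 C (muR A) (fun m => Q m)
  (fun n B => S A B n / a_seq T F n)) => //; rewrite -?F0.
- by move=> m; exact: cuts_gt0.
- move=> n B1 B2 m1 m2 BF1 BF2 B12.
  by rewrite return_sumUr// mulrDl.
- by move=> n B1; exact: return_sum_div_ge0.
- by move=> n B1 m1 BF1; exact: return_sum_le_right.
- by rewrite mulrC; exact: return_sum_left_cvg.
- by move=> m q qQ; exact: return_sum_cell_right.
Qed.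

End ReturnSums.

Theorem mainTheorem4 (R : realType) (w0 : R) (r : nat -> nat)
    (s : nat -> nat -> nat) :
  0 < w0 ->
  (forall n, (2 <= r n)%N) ->
  (exists M : nat, forall n, (r n <= M)%N) ->
  weakly_rationally_ergodic_wrt (ro_space w0 r s) (rank_one_map w0 r s)
    (I0 w0 r s).
Proof.
move=> w0_gt0 r_ge2 [M r_le]; split.
- exact: measurable_I0.
- by rewrite mu_I0// lte_fin.
- by rewrite mu_I0// ltry.
(* Level [j] is the [j]-th image of the base of its column, which lies in [I], so the images of [I]
   cover the whole space. *)
- rewrite /sweeps_out (_ : _ `\` _ = set0) ?measure0//.
  apply/seteqP; split => // x [Xx]; apply.
  by have [k kx] := space_swept w0_gt0 r_ge2 Xx; exists k.
- by move=> A B mA mB AF BF; exact: (return_sum_cvg w0_gt0 r_ge2 r_le).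
Qed.
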